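(* Let $\mathsf{P}$ be a property of r.e. theories, let $\mathsf{D_P}$ be the collection of r.e. theories with $\mathsf{P}$, and let $\sqsubseteq$ be a reflexive and transitive binary relation on r.e. theories. Suppose that for some $n\in\omega$: (1) for any $A,B\in\mathsf{D_P}$ there is a lower bound $A\oplus B\in\mathsf{D_P}$ of $A$ and $B$ under $\sqsubseteq$; (2) if $A\in\mathsf{D_P}$ and $A\sqsubseteq B$ then $B\in\mathsf{D_P}$; (3) the relation $A\sqsubseteq B$ (on indices of r.e. theories) is $\Sigma^0_n$; (4) $\{e: W_e\text{ has property }\mathsf{P}\}$ is $\Pi^0_n$-complete. Then $\langle\mathsf{D_P},\sqsubseteq\rangle$ has no minimal element, i.e. there is no $S\in\mathsf{D_P}$ such that no $T\in\mathsf{D_P}$ satisfies $T\sqsubset S$.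
   Context: $W_e$ is the $e$-th r.e. set, regarded as the r.e. theory with index $e$. $T\sqsubset S$ means $T\sqsubseteq S$ and not $S\sqsubseteq T$. *)

(* Defs.v *)
From Stdlib Require Import Arith Cantor Lia.

(* Cantor's bijection nat * nat <-> nat *)
Definition npair (x y : nat) : nat := Cantor.to_nat (x, y).
Definition nfst (z : nat) : nat := fst (Cantor.of_nat z).
Definition nsnd (z : nat) : nat := snd (Cantor.of_nat z).

(* Programs for the unary partial recursive functions; arguments of higher
   arity are tupled with [npair], whose inverses are among the initial
   functions. *)
Inductive code : Type :=
  | cZero
  | cSucc
  | cFst
  | cSnd
  | cPair (f g : code)
  | cComp (f g : code)
  | cPrec (f g : code)
  | cMin (f : code).

Fixpoint prec_graph (F G : nat -> nat -> Prop) (a n y : nat) : Prop :=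
  match n with
  | O => F a y
  | S m => exists r, prec_graph F G a m r /\ G (npair a (npair m r)) y
  end.

(* [eval c x y]: the computation of [c] on [x] converges, with value [y].
   In [cMin f] all the values of [f] below the zero found must converge. *)
Fixpoint eval (c : code) (x y : nat) {struct c} : Prop :=
  match c with
  | cZero => y = 0
  | cSucc => y = S x
  | cFst => y = nfst x
  | cSnd => y = nsnd x
  | cPair f g => exists a b, eval f x a /\ eval g x b /\ y = npair a b
  | cComp f g => exists z, eval g x z /\ eval f z y
  | cPrec f g => prec_graph (eval f) (eval g) (nfst x) (nsnd x) y
  | cMin f => eval f (npair x y) 0 /\
      forall i, i < y -> exists v, eval f (npair x i) (S v)
  end.

Definition computable (f : nat -> nat) : Prop :=
  exists c, forall x, eval c x (f x).

Definition recursive (A : nat -> Prop) : Prop :=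
  exists c, forall x, (A x -> eval c x 1) /\ (~ A x -> eval c x 0).

(* Goedel numbering of programs: [npair tag arguments]. The first argument
   of [decode_fuel] bounds the depth of the decoding; [S e] suffices for the
   number [e], since arguments of a tag >= 4 are smaller than [e]. *)
Fixpoint decode_fuel (k e : nat) : code :=
  match k with
  | O => cZero
  | S k =>
      let r := nsnd e in
      match nfst e with
      | 0 => cZero
      | 1 => cSucc
      | 2 => cFst
      | 3 => cSnd
      | 4 => cPair (decode_fuel k (nfst r)) (decode_fuel k (nsnd r))
      | 5 => cComp (decode_fuel k (nfst r)) (decode_fuel k (nsnd r))
      | 6 => cPrec (decode_fuel k (nfst r)) (decode_fuel k (nsnd r))
      | _ => cMin (decode_fuel k r)
      end
  end.

Definition decode (e : nat) : code := decode_fuel (S e) e.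

Fixpoint encode (c : code) : nat :=
  match c with
  | cZero => npair 0 0
  | cSucc => npair 1 0
  | cFst => npair 2 0
  | cSnd => npair 3 0
  | cPair f g => npair 4 (npair (encode f) (encode g))
  | cComp f g => npair 5 (npair (encode f) (encode g))
  | cPrec f g => npair 6 (npair (encode f) (encode g))
  | cMin f => npair 7 (encode f)
  end.

Definition W (e x : nat) : Prop := exists y, eval (decode e) x y.

(* Sigma^0_0 = Pi^0_0 = recursive. *)
Fixpoint Sigma0 (n : nat) (A : nat -> Prop) {struct n} : Prop :=
  match n with
  | O => recursive A
  | S m => exists B, Pi0 m B /\ forall x, A x <-> exists y, B (npair x y)
  end
with Pi0 (n : nat) (A : nat -> Prop) {struct n} : Prop :=
  match n with
  | O => recursive A
  | S m => exists B, Sigma0 m B /\ forall x, A x <-> forall y, B (npair x y)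
  end.

Definition Sigma0_rel (n : nat) (R : nat -> nat -> Prop) : Prop :=
  Sigma0 n (fun z => R (nfst z) (nsnd z)).

Definition many_one_reducible (B A : nat -> Prop) : Prop :=
  exists f, computable f /\ forall x, B x <-> A (f x).

Definition Pi0_complete (n : nat) (A : nat -> Prop) : Prop :=
  Pi0 n A /\ forall B, Pi0 n B -> many_one_reducible B A.

(* A theory is identified with the set of the Goedel numbers of its axioms. *)
Record re_theory : Type := ReTheory {
  axioms : nat -> Prop;
  axioms_re : exists e, forall x, axioms x <-> W e x
}.

Definition theory_of_index (e : nat) : re_theory :=
  ReTheory (W e) (ex_intro _ e (fun x => iff_refl (W e x))).

Definition strict (le : re_theory -> re_theory -> Prop) (T S : re_theory) : Prop :=
  le T S /\ ~ le S T.

Definition minimal (D : re_theory -> Prop)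
    (le : re_theory -> re_theory -> Prop) (S : re_theory) : Prop :=
  D S /\ ~ exists T, D T /\ strict le T S.

Lemma nfst_npair x y : nfst (npair x y) = x.
Proof. unfold nfst, npair; now rewrite Cantor.cancel_of_to. Qed.

Lemma nsnd_npair x y : nsnd (npair x y) = y.
Proof. unfold nsnd, npair; now rewrite Cantor.cancel_of_to. Qed.

Lemma npair_ge x y : x + y <= npair x y.
Proof.
unfold npair; pose proof (Cantor.to_nat_non_decreasing x y); lia.
Qed.

Lemma npair_gt_r x y : 0 < x -> y < npair x y.
Proof. intro; pose proof (npair_ge x y); lia. Qed.

(* Every program has an index. *)
Lemma decode_encode c : decode (encode c) = c.
Proof.
assert (H : forall c k, encode c < k -> decode_fuel k (encode c) = c).
{ clear c; induction c as [ | | | |f IHf g IHg|f IHf g IHg|f IHf g IHg|f IHf];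
  intros [|k] Hk; try lia; cbn [encode decode_fuel] in *;
  rewrite nfst_npair, ?nsnd_npair, ?nfst_npair; trivial;
  match type of Hk with npair ?t ?r < _ =>
    pose proof (npair_gt_r t r ltac:(lia)) end;
  try pose proof (npair_ge (encode f) (encode g));
  f_equal; (apply IHf || apply IHg); lia. }
unfold decode; apply H; lia.
Qed.

Lemma eval_functional c x y z : eval c x y -> eval c x z -> y = z.
Proof.
revert x y z.
induction c as [ | | | |f IHf g IHg|f IHf g IHg|f IHf g IHg|f IHf];
  cbn [eval]; intros x y z.
1-4: congruence.
- intros (a & b & Ha & Hb & ->) (a' & b' & Ha' & Hb' & ->).
  now rewrite (IHf _ _ _ Ha Ha'), (IHg _ _ _ Hb Hb').
- intros (a & Ha & Hy) (b & Hb & Hz).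
  rewrite (IHg _ _ _ Ha Hb) in Hy; eauto.
- revert y z; induction (nsnd x) as [|n IHn]; cbn [prec_graph]; intros y z.
  + apply IHf.
  + intros (r & Hr & Hy) (s & Hs & Hz).
    rewrite (IHn _ _ Hr Hs) in Hy; eauto.
- intros [Hy Hy'] [Hz Hz'].
  destruct (lt_eq_lt_dec y z) as [[L|E]|L]; trivial.
  + destruct (Hz' _ L) as [v Hv]; now pose proof (IHf _ _ _ Hy Hv).
  + destruct (Hy' _ L) as [v Hv]; now pose proof (IHf _ _ _ Hz Hv).
Qed.

(* Main.v *)
(** A minimal element [S] is the least one, because [S] is equivalent to any lower bound of
    itself and another element of [P].  Hence [P T] iff [le S T], so that the index set of [P]
    is Sigma^0_n and its complement is Pi^0_n.  By completeness a computable [f] reduces the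
    complement to the index set itself, which is absurd at a number [e] such that [W e = W (f e)],
    provided by the recursion theorem.  The recursion theorem needs a universal program; it
    runs an abstract stack machine until the stack is empty. *)

From Stdlib Require Import Arith Cantor Lia Classical FunctionalExtensionality
  PropExtensionality.
Require Import Defs.

Local Arguments npair : simpl never.
Local Arguments nfst : simpl never.
Local Arguments nsnd : simpl never.
Local Arguments decode : simpl never.

(** * Inverse laws and bounds of the pairing function *)

Lemma npair_surj z : npair (nfst z) (nsnd z) = z.
Proof.
  unfold npair, nfst, nsnd.
  now rewrite <- surjective_pairing, Cantor.cancel_to_of.
Qed.

Lemma nfst_le z : nfst z <= z.
Proof. pose proof (npair_ge (nfst z) (nsnd z)); rewrite npair_surj in *; lia. Qed.

Lemma nsnd_le z : nsnd z <= z.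
Proof. pose proof (npair_ge (nfst z) (nsnd z)); rewrite npair_surj in *; lia. Qed.

Lemma nsnd_lt z : 0 < nfst z -> nsnd z < z.
Proof. pose proof (npair_ge (nfst z) (nsnd z)); rewrite npair_surj in *; lia. Qed.

(** * Closure properties of the computable functions *)

Lemma computable_ext f g : (forall x, f x = g x) -> computable f -> computable g.
Proof. intros E [c Hc]; exists c; intro x; rewrite <- E; apply Hc. Qed.

Lemma computable_id : computable (fun x => x).
Proof.
  exists (cPair cFst cSnd); intro x; cbn.
  exists (nfst x), (nsnd x); now rewrite npair_surj.
Qed.

Lemma computable_comp f g :
  computable f -> computable g -> computable (fun x => f (g x)).
Proof. intros [c Hc] [d Hd]; exists (cComp c d); intro x; cbn; eauto. Qed.

Lemma computable_S f : computable f -> computable (fun x => S (f x)).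
Proof. apply (computable_comp S); now exists cSucc. Qed.

Lemma computable_nfst f : computable f -> computable (fun x => nfst (f x)).
Proof. apply (computable_comp nfst); now exists cFst. Qed.

Lemma computable_nsnd f : computable f -> computable (fun x => nsnd (f x)).
Proof. apply (computable_comp nsnd); now exists cSnd. Qed.

Lemma computable_npair f g :
  computable f -> computable g -> computable (fun x => npair (f x) (g x)).
Proof.
  intros [c Hc] [d Hd]; exists (cPair c d); intro x; cbn; eauto 6.
Qed.

Fixpoint const_code (k : nat) : code :=
  match k with
  | 0 => cZero
  | S k => cComp cSucc (const_code k)
  end.

Lemma eval_const_code k x : eval (const_code k) x k.
Proof. induction k as [|k IH]; cbn; eauto. Qed.

Lemma computable_const k : computable (fun _ => k).
Proof. exists (const_code k); apply eval_const_code. Qed.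

(** [cPrec] expects a parameter paired with a counter; the whole input [x] serves as the parameter,
    so that the step function can still see it. *)
Lemma computable_rec f g h :
  computable f -> computable g -> computable h ->
  computable (fun x =>
    nat_rec (fun _ => nat) (g x) (fun m r => h (npair x (npair m r))) (f x)).
Proof.
  intros Hf [cg Hg] [ch Hh].
  destruct (computable_npair _ _ computable_id Hf) as [cf Hcf].
  exists (cComp (cPrec cg ch) cf); intro x.
  exists (npair x (f x)); split; [apply Hcf|].
  cbn [eval]; rewrite nfst_npair, nsnd_npair.
  induction (f x) as [|m IH]; cbn; eauto.
Qed.

(** Case distinction under a name of its own, which [computability] can recognise where it could not
    handle a raw [match]. *)
Definition ifz (c a b : nat) : nat := match c with 0 => a | S _ => b end.

Lemma computable_ifz f g h :
  computable f -> computable g -> computable h ->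
  computable (fun x => ifz (f x) (g x) (h x)).
Proof.
  intros Hf Hg Hh.
  refine (computable_ext _ _ _ (computable_rec f g (fun z => h (nfst z)) Hf Hg _)).
  - intro x; destruct (f x); cbn; now rewrite ?nfst_npair.
  - apply computable_comp; [assumption|]; apply computable_nfst, computable_id.
Qed.

Lemma computable_pred f : computable f -> computable (fun x => pred (f x)).
Proof.
  intro Hf.
  refine (computable_ext _ _ _
    (computable_rec f (fun _ => 0) (fun z => nfst (nsnd z)) Hf (computable_const 0) _)).
  - intro x; destruct (f x); cbn; now rewrite ?nsnd_npair, ?nfst_npair.
  - apply computable_nfst, computable_nsnd, computable_id.
Qed.

Lemma computable_iter f g h :
  computable f -> computable g -> computable h ->
  computable (fun x => Nat.iter (f x) g (h x)).
Proof.
  intros Hf Hg Hh.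
  refine (computable_ext _ _ _
    (computable_rec f h (fun z => g (nsnd (nsnd z))) Hf Hh _)).
  - intro x; induction (f x) as [|m IH]; cbn; [reflexivity|].
    now rewrite !nsnd_npair, IH.
  - apply computable_comp; [assumption|]; apply computable_nsnd, computable_nsnd, computable_id.
Qed.

(* The lemma is selected by the syntactic head, since [apply] alone would unfold [npair].
   Unification may leave an eta-contracted function, which is expanded first. *)
Ltac computability :=
  repeat (assumption ||
    lazymatch goal with
    | |- computable ?f => change (computable (fun x => f x)); cbv beta
    end;
    lazymatch goal with
    | |- computable (fun x => x) => apply computable_id
    | |- computable (fun x => S _) => apply computable_S
    | |- computable (fun x => nfst _) => apply computable_nfst
    | |- computable (fun x => nsnd _) => apply computable_nsnd
    | |- computable (fun x => npair _ _) => apply computable_npair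
    | |- computable (fun x => pred _) => apply computable_pred
    | |- computable (fun x => ifz _ _ _) => apply computable_ifz
    | |- _ => apply computable_const
    end).

(** * A stack machine running encoded programs *)

(* A state pairs a stack of frames with the current value: [fRun e] applies the program [e] to
   the value, and the other frames are the continuations of [cPair], [cPrec] and [cMin]. *)
Definition fRun (e : nat) : nat := npair 0 e.
Definition fPairL (g x : nat) : nat := npair 1 (npair g x).
Definition fPairR (a : nat) : nat := npair 2 a.
Definition fPrec (g a m k : nat) : nat := npair 3 (npair g (npair a (npair m k))).
Definition fMin (f x i : nat) : nat := npair 4 (npair f (npair x i)).

(** The successor reserves [0] for the empty stack. *)
Definition push (fr K : nat) : nat := S (npair fr K).

(** The tags are tested in the order of [decode_fuel]; the last branch takes every tag from 7 on. *)
Definition run_step (e K v : nat) : nat :=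
  let t := nfst e in
  let r := nsnd e in
  ifz t (npair K 0)
  (ifz (pred t) (npair K (S v))
  (ifz (pred (pred t)) (npair K (nfst v))
  (ifz (pred (pred (pred t))) (npair K (nsnd v))
  (ifz (pred (pred (pred (pred t))))
     (npair (push (fRun (nfst r)) (push (fPairL (nsnd r) v) K)) v)
  (ifz (pred (pred (pred (pred (pred t)))))
     (npair (push (fRun (nsnd r)) (push (fRun (nfst r)) K)) v)
  (ifz (pred (pred (pred (pred (pred (pred t))))))
     (npair (push (fRun (nfst r)) (push (fPrec (nsnd r) (nfst v) 0 (nsnd v)) K)) (nfst v))
     (npair (push (fRun r) (push (fMin r v 0) K)) (npair v 0)))))))).

(** Here [m] iterations are done, [k] remain, and [v] is the value of the recursion at [m]. *)
Definition prec_step (g a m k K v : nat) : nat :=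
  ifz k (npair K v)
    (npair (push (fRun g) (push (fPrec g a (S m) (pred k)) K)) (npair a (npair m v))).

Definition min_step (f x i K v : nat) : nat :=
  ifz v (npair K i)
    (npair (push (fRun f) (push (fMin f x (S i)) K)) (npair x (S i))).

Definition frame_step (fr K v : nat) : nat :=
  let t := nfst fr in
  let d := nsnd fr in
  ifz t (run_step d K v)
  (ifz (pred t) (npair (push (fRun (nfst d)) (push (fPairR v) K)) (nsnd d))
  (ifz (pred (pred t)) (npair K (npair d v))
  (ifz (pred (pred (pred t)))
     (prec_step (nfst d) (nfst (nsnd d)) (nfst (nsnd (nsnd d))) (nsnd (nsnd (nsnd d))) K v)
     (min_step (nfst d) (nfst (nsnd d)) (nsnd (nsnd d)) K v)))).

Definition step (s : nat) : nat :=
  let q := pred (nfst s) in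
  ifz (nfst s) s (frame_step (nfst q) (nsnd q) (nsnd s)).

Lemma computable_step : computable step.
Proof.
  unfold step, frame_step, run_step, prec_step, min_step,
    push, fRun, fPairL, fPairR, fPrec, fMin.
  computability.
Qed.

Ltac unpair := repeat (rewrite nfst_npair || rewrite nsnd_npair).

Lemma step_push fr K v : step (npair (push fr K) v) = frame_step fr K v.
Proof. unfold step, push; unpair; cbn; now unpair. Qed.

Lemma step_run e K v : step (npair (push (fRun e) K) v) = run_step e K v.
Proof. rewrite step_push; unfold frame_step, fRun; unpair; cbn; now unpair. Qed.

Lemma step_pairL g x K v :
  step (npair (push (fPairL g x) K) v) = npair (push (fRun g) (push (fPairR v) K)) x.
Proof. rewrite step_push; unfold frame_step, fPairL; unpair; cbn; now unpair. Qed.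

Lemma step_pairR a K v : step (npair (push (fPairR a) K) v) = npair K (npair a v).
Proof. rewrite step_push; unfold frame_step, fPairR; unpair; cbn; now unpair. Qed.

Lemma step_prec g a m k K v :
  step (npair (push (fPrec g a m k) K) v) = prec_step g a m k K v.
Proof. rewrite step_push; unfold frame_step, fPrec; unpair; cbn; now unpair. Qed.

Lemma step_min f x i K v :
  step (npair (push (fMin f x i) K) v) = min_step f x i K v.
Proof. rewrite step_push; unfold frame_step, fMin; unpair; cbn; now unpair. Qed.

Definition halts_in (t s : nat) : Prop := nfst (Nat.iter t step s) = 0.

Lemma halts_in_S t s : halts_in (S t) s <-> halts_in t (step s).
Proof. unfold halts_in; now rewrite Nat.iter_succ_r. Qed.

Lemma halts_in_push t fr K v :
  halts_in t (npair (push fr K) v) ->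
  exists t', t' < t /\ halts_in t' (step (npair (push fr K) v)).
Proof.
  destruct t as [|t]; intro H.
  - unfold halts_in in H; cbn in H; rewrite nfst_npair in H; discriminate.
  - apply halts_in_S in H; exists t; split; [lia|assumption].
Qed.

Definition halts (s : nat) : Prop := exists t, halts_in t s.

Lemma halts_step s : halts (step s) -> halts s.
Proof. intros [t Ht]; exists (S t); now apply halts_in_S. Qed.

(** * The machine agrees with [eval] *)

(** Subprograms have numbers below [e], so any two amounts of fuel above [e] give the same
    result. *)
Lemma decode_fuel_enough k e : e < k -> decode_fuel k e = decode e.
Proof.
  assert (H : forall k l e, e < k -> e < l -> decode_fuel k e = decode_fuel l e).
  { clear; induction k as [|k IH]; intros [|l] e Hk Hl; try lia; cbn.
    pose proof (nsnd_lt e) as Hr.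
    pose proof (nfst_le (nsnd e)); pose proof (nsnd_le (nsnd e)).
    destruct (nfst e) as [|[|[|[|[|[|[|t]]]]]]]; trivial;
      f_equal; apply IH; lia. }
  intro; apply H; lia.
Qed.

Lemma decode_eq e :
  decode e =
  let r := nsnd e in
  match nfst e with
  | 0 => cZero
  | 1 => cSucc
  | 2 => cFst
  | 3 => cSnd
  | 4 => cPair (decode (nfst r)) (decode (nsnd r))
  | 5 => cComp (decode (nfst r)) (decode (nsnd r))
  | 6 => cPrec (decode (nfst r)) (decode (nsnd r))
  | _ => cMin (decode r)
  end.
Proof.
  unfold decode at 1; cbn [decode_fuel].
  pose proof (nsnd_lt e) as Hr.
  pose proof (nfst_le (nsnd e)); pose proof (nsnd_le (nsnd e)).
  destruct (nfst e) as [|[|[|[|[|[|[|t]]]]]]]; trivial;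
    cbn zeta; rewrite !decode_fuel_enough by lia; reflexivity.
Qed.

(** The arbitrary stack [K] stands for the rest of the computation, so the induction hypothesis
    applies to a subprogram below any frames pushed for it. *)
Lemma eval_halts e x y K :
  eval (decode e) x y -> halts (npair K y) -> halts (npair (push (fRun e) K) x).
Proof.
  revert x y K; induction e as [e IH] using lt_wf_ind; intros x y K.
  rewrite decode_eq; intros He HK.
  apply halts_step; rewrite step_run; unfold run_step.
  pose proof (nsnd_lt e) as Hr.
  pose proof (nfst_le (nsnd e)) as Hr1; pose proof (nsnd_le (nsnd e)) as Hr2.
  cbn zeta in *; set (r := nsnd e) in *.
  destruct (nfst e) as [|[|[|[|[|[|[|t]]]]]]]; cbn in *; try (now subst y).
  - destruct He as (a & b & Ha & Hb & ->).
    refine (IH _ _ _ _ _ Ha _); [lia|].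
    apply halts_step; rewrite step_pairL.
    refine (IH _ _ _ _ _ Hb _); [lia|].
    apply halts_step; now rewrite step_pairR.
  - destruct He as (a & Ha & Hb).
    refine (IH _ _ _ _ _ Ha _); [lia|].
    refine (IH _ _ _ _ _ Hb _); [lia|assumption].
  (* Induction on the iterations already done, removing the last one as [prec_graph] does; the total
     [m + k] is what the initial frame contains. *)
  - assert (H : forall m k z,
      prec_graph (eval (decode (nfst r))) (eval (decode (nsnd r))) (nfst x) m z ->
      halts (npair (push (fPrec (nsnd r) (nfst x) m k) K) z) ->
      halts (npair (push (fRun (nfst r))
               (push (fPrec (nsnd r) (nfst x) 0 (m + k)) K)) (nfst x))).
    { induction m as [|m IHm]; cbn; intros k z Hz HH.
      - refine (IH _ _ _ _ _ Hz _); [lia|assumption].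
      - destruct Hz as (z' & Hz' & Hz).
        replace (S (m + k)) with (m + S k) by lia.
        refine (IHm _ _ Hz' _).
        apply halts_step; rewrite step_prec; cbn.
        refine (IH _ _ _ _ _ Hz _); [lia|assumption]. }
    rewrite <- (Nat.add_0_r (nsnd x)).
    refine (H _ _ _ He _).
    apply halts_step; now rewrite step_prec.
  - destruct He as [Hy Hlt].
    (* The search is traced back from [i] to [0]: all values below [y] are positive, so the machine
       does reach [i]. *)
    assert (H : forall i, i <= y ->
      halts (npair (push (fRun r) (push (fMin r x i) K)) (npair x i)) ->
      halts (npair (push (fRun r) (push (fMin r x 0) K)) (npair x 0))).
    { induction i as [|i IHi]; intros Hi HH; [assumption|].
      apply IHi; [lia|].
      destruct (Hlt i Hi) as [v Hv].
      refine (IH _ _ _ _ _ Hv _); [lia|].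
      apply halts_step; now rewrite step_min. }
    apply (H y); [lia|].
    refine (IH _ _ _ _ _ Hy _); [lia|].
    apply halts_step; now rewrite step_min.
Qed.

(* The strict decrease of the halting time makes the induction for [cMin] well-founded. *)
Lemma halts_in_eval e x K t :
  halts_in t (npair (push (fRun e) K) x) ->
  exists y t', t' < t /\ eval (decode e) x y /\ halts_in t' (npair K y).
Proof.
  revert x K t; induction e as [e IH] using lt_wf_ind; intros x K t H.
  rewrite decode_eq.
  destruct (halts_in_push _ _ _ _ H) as (t1 & L1 & H1); clear H.
  rewrite step_run in H1; unfold run_step in H1.
  pose proof (nsnd_lt e) as Hr.
  pose proof (nfst_le (nsnd e)) as Hr1; pose proof (nsnd_le (nsnd e)) as Hr2.
  cbn zeta in *; set (r := nsnd e) in *.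
  destruct (nfst e) as [|[|[|[|[|[|[|tag]]]]]]]; cbn in *; eauto.
  - destruct (IH (nfst r) ltac:(lia) _ _ _ H1) as (a & t2 & L2 & Ha & H2).
    destruct (halts_in_push _ _ _ _ H2) as (t3 & L3 & H3); rewrite step_pairL in H3.
    destruct (IH (nsnd r) ltac:(lia) _ _ _ H3) as (b & t4 & L4 & Hb & H4).
    destruct (halts_in_push _ _ _ _ H4) as (t5 & L5 & H5); rewrite step_pairR in H5.
    exists (npair a b), t5; split; [lia|]; eauto 8.
  - destruct (IH (nsnd r) ltac:(lia) _ _ _ H1) as (a & t2 & L2 & Ha & H2).
    destruct (IH (nfst r) ltac:(lia) _ _ _ H2) as (b & t3 & L3 & Hb & H3).
    exists b, t3; split; [lia|]; eauto.
  - destruct (IH (nfst r) ltac:(lia) _ _ _ H1) as (z & t2 & L2 & Hz & H2).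
    (* Now the machine is followed forwards, so the induction is on the number [k] of remaining
       iterations. *)
    assert (Hp : forall k m z t,
      prec_graph (eval (decode (nfst r))) (eval (decode (nsnd r))) (nfst x) m z ->
      halts_in t (npair (push (fPrec (nsnd r) (nfst x) m k) K) z) ->
      exists y t', t' < t /\
        prec_graph (eval (decode (nfst r))) (eval (decode (nsnd r))) (nfst x) (m + k) y /\
        halts_in t' (npair K y)).
    { clear - IH Hr Hr1 Hr2; induction k as [|k IHk]; intros m z t Hz H;
        destruct (halts_in_push _ _ _ _ H) as (t1 & L1 & H1);
        rewrite step_prec in H1; cbn in H1.
      - rewrite Nat.add_0_r; eauto.
      - destruct (IH (nsnd r) ltac:(lia) _ _ _ H1) as (z' & t2 & L2 & Hz' & H2).
        destruct (IHk (S m) z' t2) as (y & t3 & L3 & Hy & H3); [cbn; eauto|assumption|].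
        replace (m + S k) with (S m + k) by lia.
        exists y, t3; split; [lia|]; auto. }
    destruct (Hp (nsnd x) 0 z t2 Hz H2) as (y & t3 & L3 & Hy & H3).
    exists y, t3; split; [lia|]; auto.
  - assert (Hm : forall t i,
      (forall j, j < i -> exists v, eval (decode r) (npair x j) (S v)) ->
      halts_in t (npair (push (fRun r) (push (fMin r x i) K)) (npair x i)) ->
      exists y t', t' < t /\
        (eval (decode r) (npair x y) 0 /\
         forall j, j < y -> exists v, eval (decode r) (npair x j) (S v)) /\
        halts_in t' (npair K y)).
    { clear - IH Hr Hr1 Hr2; induction t as [t IHt] using lt_wf_ind; intros i Hi H.
      destruct (IH r ltac:(lia) _ _ _ H) as (v & t1 & L1 & Hv & H1).
      destruct (halts_in_push _ _ _ _ H1) as (t2 & L2 & H2); rewrite step_min in H2.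
      destruct v as [|v]; cbn in H2.
      - exists i, t2; split; [lia|]; auto.
      - destruct (IHt t2 ltac:(lia) (S i)) as (y & t3 & L3 & Hy & H3); trivial.
        + intros j Hj; destruct (Nat.eq_dec j i) as [->|]; [eauto|apply Hi; lia].
        + exists y, t3; split; [lia|]; auto. }
    destruct (Hm t1 0 ltac:(intros j Hj; lia) H1) as (y & t2 & L2 & Hy & H2).
    exists y, t2; split; [lia|]; auto.
Qed.

(** * The recursion theorem *)

(** [W] concerns convergence only, so it suffices to search for a time at which the stack is empty;
    the value found is that time, not the output. *)
Lemma universal_domain :
  exists u, forall e x, (exists t, eval u (npair e x) t) <-> W e x.
Proof.
  pose (g z := nfst (Nat.iter (nsnd z) step
    (npair (push (fRun (nfst (nfst z))) 0) (nsnd (nfst z))))).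
  assert (Hg : computable g).
  { apply computable_nfst, computable_iter;
      [ | apply computable_step | unfold push, fRun ]; computability. }
  assert (Eg : forall e x t,
    g (npair (npair e x) t) = 0 <-> halts_in t (npair (push (fRun e) 0) x)).
  { intros; unfold g, halts_in; unpair; reflexivity. }
  destruct Hg as [c Hc]; exists (cMin c); intros e x; cbn; split.
  - intros (t & Ht & _).
    assert (H : halts_in t (npair (push (fRun e) 0) x))
      by (apply Eg; exact (eval_functional _ _ _ _ (Hc _) Ht)).
    destruct (halts_in_eval _ _ _ _ H) as (y & _ & _ & Hy & _); now exists y.
  - intros [y Hy].
    destruct (eval_halts e x y 0 Hy) as [t Ht].
    { exists 0; unfold halts_in; cbn; apply nfst_npair. }
    apply Eg in Ht.
    (* [cMin] returns the first zero, hence the least halting time is needed; [g] is total, so all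
       earlier values converge. *)
    destruct (dec_inh_nat_subset_has_unique_least_element
      (fun t => g (npair (npair e x) t) = 0)) as (m & [Hm Hmin] & _); [|now exists t|].
    { intro k; destruct (g (npair (npair e x) k)); [now left|now right]. }
    exists m; split; [rewrite <- Hm; apply Hc|].
    intros i Hi; pose proof (Hc (npair (npair e x) i)) as He.
    destruct (g (npair (npair e x) i)) as [|v] eqn:E; [|now exists v].
    pose proof (Hmin i E); lia.
Qed.

(** Hard-wiring a number into a program is computable, as in the s-m-n theorem: each iteration
    composes with the successor, whose code is [npair 1 0]. *)
Lemma computable_encode_const : computable (fun k => encode (const_code k)).
Proof.
  refine (computable_ext
    (fun k => Nat.iter k (fun r => npair 5 (npair (npair 1 0) r)) (npair 0 0)) _ _ _).
  - intro k; induction k as [|k IH]; [reflexivity|].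
    now rewrite Nat.iter_succ, IH.
  - apply computable_iter; computability.
Qed.

Theorem recursion_theorem f :
  computable f -> exists e, forall x, W e x <-> W (f e) x.
Proof.
  intro Hf.
  destruct universal_domain as [u Hu].
  pose (idc := cPair cFst cSnd).
  (* [diag d] is an index of the program that runs the program [d] on [npair d x]. *)
  pose (diag d := npair 5 (npair d (npair 4 (npair (encode (const_code d)) (encode idc))))).
  assert (Hd : computable diag).
  { unfold diag; computability; apply computable_encode_const. }
  assert (Hp : computable (fun z => npair (f (diag (nfst z))) (nsnd z))).
  { computability; apply (computable_comp f); [assumption|].
    apply (computable_comp diag); computability. }
  destruct Hp as [p Hp].
  (* On [npair d x] this program runs the program [f (diag d)] on [x]. Since [diag d] runs [d] on
     exactly that input, it is the required fixed point. *)
  pose (d := encode (cComp u p)); exists (diag d); intro x.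
  assert (E : decode (diag d) = cComp (cComp u p) (cPair (const_code d) idc)).
  { exact (decode_encode (cComp (cComp u p) (cPair (const_code d) idc))). }
  rewrite <- (Hu (f (diag d))); unfold W; rewrite E.
  assert (Hz : eval (cPair (const_code d) idc) x (npair d x)).
  { cbn; exists d, x; split; [apply eval_const_code|]; split; [|reflexivity].
    exists (nfst x), (nsnd x); now rewrite npair_surj. }
  specialize (Hp (npair d x)); rewrite nfst_npair, nsnd_npair in Hp.
  split.
  - intros (y & z & Hz' & q & Hq & Hy); exists y.
    pose proof (eval_functional _ _ _ _ Hz Hz'); subst z.
    now rewrite (eval_functional _ _ _ _ Hp Hq).
  - intros [y Hy]; exists y, (npair d x); split; [assumption|].
    now exists (npair (f (diag d)) x).
Qed.

(** * The arithmetical hierarchy *)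

(** Under a quantifier [g] acts on the first component and the bound variable is kept. Both classes
    are treated at once because they alternate in the induction. *)
Lemma Sigma0_Pi0_preimage n : forall A B g, computable g ->
  (forall x, B x <-> A (g x)) ->
  (Sigma0 n A -> Sigma0 n B) /\ (Pi0 n A -> Pi0 n B).
Proof.
  induction n as [|n IH]; intros A B g Hg HB.
  - assert (H : recursive A -> recursive B); [|split; exact H].
    intros [c Hc]; destruct Hg as [d Hd]; exists (cComp c d).
    intro x; specialize (Hc (g x)); rewrite <- HB in Hc; cbn.
    split; intro H; exists (g x); split; auto; now apply Hc.
  - assert (Hh : computable (fun z => npair (g (nfst z)) (nsnd z))).
    { computability; apply (computable_comp g); computability. }
    split; intros (C & HC & HA);
      exists (fun z => C (npair (g (nfst z)) (nsnd z)));
      (split;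
       [ refine (_ (IH C _ _ Hh (fun x => iff_refl _))); intros [? ?]; auto
       | intro x; rewrite HB, HA; setoid_rewrite nfst_npair; setoid_rewrite nsnd_npair;
         reflexivity ]).
Qed.

Lemma Sigma0_Pi0_complement n : forall A B, (forall x, B x <-> ~ A x) ->
  (Sigma0 n A -> Pi0 n B) /\ (Pi0 n A -> Sigma0 n B).
Proof.
  induction n as [|n IH]; intros A B HB.
  - assert (H : recursive A -> recursive B); [|split; exact H].
    intros [c Hc].
    (* This function exchanges the characteristic values 0 and 1. *)
    assert (Hn : computable (fun v => ifz v 1 0)) by computability.
    destruct Hn as [d Hd]; exists (cComp d c).
    intro x; specialize (HB x); destruct (Hc x) as [H1 H0]; cbn.
    split; intro H.
    + exists 0; split; [apply H0; tauto|apply (Hd 0)].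
    + exists 1; split; [apply H1, NNPP; tauto|apply (Hd 1)].
  - split; intros (C & HC & HA); exists (fun z => ~ C z);
      (split; [now apply (IH C _ (fun x => iff_refl _))|]);
      intro x; rewrite HB, HA.
    + split; [intros H y Hy; eauto|intros H [y Hy]; exact (H y Hy)].
    + split; [intro H; now apply not_all_ex_not in H|intros [y Hy] H; auto].
Qed.

(** * Minimal elements and the contradiction *)

(** [P] and [le] are arbitrary on records, so theories with the same axioms must be made equal in
    order to be exchanged inside them. *)
Lemma re_theory_ext (A B : re_theory) :
  (forall x, axioms A x <-> axioms B x) -> A = B.
Proof.
  destruct A as [a Ha], B as [b Hb]; cbn; intro H.
  assert (E : a = b).
  { apply functional_extensionality; intro x; apply propositional_extensionality, H. }
  subst b; f_equal; apply proof_irrelevance.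
Qed.

Lemma minimal_is_least
  (P : re_theory -> Prop)
  (le : re_theory -> re_theory -> Prop)
  (le_trans : forall A B C : re_theory, le A B -> le B C -> le A C)
  (lower_bounds : forall A B : re_theory, P A -> P B ->
     exists C : re_theory, P C /\ le C A /\ le C B)
  (S : re_theory) :
  minimal P le S -> forall A, P A -> le S A.
Proof.
  intros [HS Hmin] A HA.
  destruct (lower_bounds A S HA HS) as (C & HC & HCA & HCS).
  apply le_trans with C; [|assumption].
  (* Otherwise [C] would be strictly below [S]. *)
  apply NNPP; intro H; apply Hmin; exists C; now repeat split.
Qed.

Theorem theorem4p24
  (P : re_theory -> Prop)
  (le : re_theory -> re_theory -> Prop)
  (le_refl : forall A : re_theory, le A A)
  (le_trans : forall A B C : re_theory, le A B -> le B C -> le A C)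
  (n : nat)
  (lower_bounds : forall A B : re_theory, P A -> P B ->
     exists C : re_theory, P C /\ le C A /\ le C B)
  (upward_closed : forall A B : re_theory, P A -> le A B -> P B)
  (le_Sigma : Sigma0_rel n
     (fun i j => le (theory_of_index i) (theory_of_index j)))
  (P_Pi_complete : Pi0_complete n (fun e => P (theory_of_index e))) :
  ~ exists S : re_theory, minimal P le S.
Proof.
  intros [S HS].
  pose proof (minimal_is_least P le le_trans lower_bounds S HS) as Hleast.
  destruct HS as [HS _].
  assert (HsS : exists s, S = theory_of_index s).
  { destruct (axioms_re S) as [s Hs]; exists s; now apply re_theory_ext. }
  destruct HsS as [s ->].
  assert (HSigma : Sigma0 n (fun e => P (theory_of_index e))).
  { refine (proj1 (Sigma0_Pi0_preimage n _ _ (npair s) _ _) le_Sigma).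
    - apply computable_npair; [apply computable_const|apply computable_id].
    - intro e; rewrite nfst_npair, nsnd_npair; split; [apply Hleast|].
      now apply upward_closed. }
  destruct P_Pi_complete as [_ Hcomplete].
  destruct (Hcomplete (fun e => ~ P (theory_of_index e))) as (f & Hf & Hred).
  { now apply (Sigma0_Pi0_complement n _ _ (fun x => iff_refl _)). }
  destruct (recursion_theorem f Hf) as [e He].
  assert (E : theory_of_index e = theory_of_index (f e)) by now apply re_theory_ext.
  (* At the fixed point the reduction says that [P] fails for [theory_of_index e] exactly when it
     holds for it. *)
  specialize (Hred e); rewrite <- E in Hred; tauto.
Qed.
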